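(* Let $U = U_1 \sqcup U_2$ and $V = V_1 \sqcup V_2$ be disjoint sets of vertices with $|U| = n$, $|U_i| = n_i$, $|V| = m$, $|V_i| = m_i$ and $1 \leq n_i, m_i$ for $i = 1, 2$, where $U=\{x_1,\ldots,x_n\}$, $U_1=\{x_1,\ldots,x_{n_1}\}$, $V=\{y_1,\ldots,y_m\}$, $V_1=\{y_1,\ldots,y_{m_1}\}$. Let $G$ be the bipartite graph $K_{U_1, V}\cup K_{U_2, V_2}$. Let $K$ be a field, let $R = K[x_1, \ldots, x_n, y_1, \ldots, y_m]$ with the standard grading, and let $J_G \subset R$ denote the cover ideal of $G$. Then the graded minimal free resolution of $R/J_G$ is of the form \[ 0 \longrightarrow R(-n-m_2) \oplus R(-m-n_1) \longrightarrow R(-(n_1+m_2)) \oplus R(-m) \oplus R(-n) \longrightarrow R \longrightarrow 0. \] In particular, \[ \operatorname{reg}(J_G) = \max \{ n+ m_2-1,\ m+ n_1 -1\}. \]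
   Context: For disjoint vertex sets $A,B$, $K_{A,B}$ denotes the complete bipartite graph on $A\sqcup B$ (edges: all $\{a,b\}$ with $a\in A$, $b\in B$). For graphs $G,H$, $G\cup H$ is the graph with vertex set $V(G)\cup V(H)$ and edge set $E(G)\cup E(H)$. A vertex cover of $G$ is a set $w$ of vertices meeting every edge. The cover ideal $J_G$ is the ideal generated by the squarefree monomials $\prod_{v\in w}v$ with $w$ a vertex cover of $G$ (vertices identified with variables); equivalently $J_G=\bigcap_{\{u,v\}\in E(G)}(u,v)$. For a finitely generated graded $R$-module $M$, $\operatorname{reg}(M)=\max\{j-i : \operatorname{Tor}_i^R(M,K)_j\neq 0\}$ is the Castelnuovo-Mumford regularity. *)

(* Defs.v *)
From HB Require Import structures.
From mathcomp Require Import all_boot all_order all_algebra.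
From mathcomp Require Import generic_quotient ring_quotient.
From mathcomp Require Import mpoly.
From mathcomp Require Import boolp.

Set Implicit Arguments.
Unset Strict Implicit.
Unset Printing Implicit Defensive.

Import Order.TTheory GRing.Theory Num.Theory.

Local Open Scope ring_scope.

(* Graphs carry their own vertex set inside an ambient finite type, so that   *)
(* the union of two graphs on different vertex sets makes sense.              *)
Record graph (T : finType) := Graph {
  verts : {set T};
  edges : {set {set T}}
}.

Definition complete_bipartite (T : finType) (A B : {set T}) : graph T :=
  Graph (A :|: B) [set [set a; b] | a in A, b in B].

Definition graph_union (T : finType) (G H : graph T) : graph T :=
  Graph (verts G :|: verts H) (edges G :|: edges H).

Definition vertex_cover (T : finType) (G : graph T) (w : {set T}) : bool :=
  (w \subset verts G) && [forall e in edges G, e :&: w != set0].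

Definition ideal_gen (A : comNzRingType) (S : seq A) : {pred A^o} :=
  fun f => `[< exists c : 'I_(size S) -> A, f = \sum_i c i * S`_i >].

Lemma ideal_gen_submod_closed (A : comNzRingType) (S : seq A) :
  submod_closed (ideal_gen S).
Proof.
split=> [|a x y /asboolP[c ->] /asboolP[d ->]]; apply/asboolP.
  by exists (fun=> 0); rewrite big1 // => i _; rewrite mul0r.
exists (fun i => a * c i + d i); rewrite scaler_sumr -big_split /=.
by apply: eq_bigr => i _; rewrite mulrDl -mulrA.
Qed.

HB.instance Definition _ (A : comNzRingType) (S : seq A) :=
  GRing.isSubmodClosed.Build A A^o (ideal_gen S) (ideal_gen_submod_closed S).

Record ideal_mod (A : comNzRingType) (S : seq A) := IdealMod {
  ideal_val : A^o;
  _ : ideal_val \in ideal_gen S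
}.

HB.instance Definition _ (A : comNzRingType) (S : seq A) :=
  [isSub for @ideal_val A S].
HB.instance Definition _ (A : comNzRingType) (S : seq A) :=
  [Choice of ideal_mod S by <:].
HB.instance Definition _ (A : comNzRingType) (S : seq A) :=
  [SubChoice_isSubLmodule of ideal_mod S by <:].

(* The library's quotient is only a Z-module (a ring for proper ideals); this *)
(* alias of it carries the A-module structure.                                *)
Definition quot_mod (A : comNzRingType) (S : seq A) : Type :=
  Quotient.quot (ideal_gen S : zmodClosed A^o).

HB.instance Definition _ (A : comNzRingType) (S : seq A) :=
  GRing.Zmodule.on (quot_mod S).

Section QuotMod.
Local Open Scope quotient_scope.
Variables (A : comNzRingType) (S : seq A).

Definition quot_pi (f : A) : quot_mod S :=
  \pi_(Quotient.quot (ideal_gen S : zmodClosed A^o)) (f : A^o).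

Definition quot_repr (x : quot_mod S) : A :=
  repr (x : Quotient.quot (ideal_gen S : zmodClosed A^o)).

Lemma quot_reprK : cancel quot_repr quot_pi.
Proof. by move=> x; rewrite /quot_pi /quot_repr reprK. Qed.

Lemma quot_piP (f g : A) : quot_pi f = quot_pi g <-> f - g \in ideal_gen S.
Proof.
rewrite (Quotient.idealrBE (ideal_gen S : zmodClosed A^o)).
by split=> [/eqP|/eqP].
Qed.

Lemma quot_piD (f g : A) : quot_pi (f + g) = quot_pi f + quot_pi g.
Proof.
exact: (raddfD (\pi_(Quotient.quot (ideal_gen S : zmodClosed A^o)))).
Qed.

Definition quot_scale (a : A) (x : quot_mod S) : quot_mod S :=
  quot_pi (a * quot_repr x).

Lemma quot_scale_pi (a f : A) : quot_scale a (quot_pi f) = quot_pi (a * f).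
Proof.
apply/quot_piP; rewrite -mulrBr.
by apply: (rpredZ a); apply/quot_piP; rewrite quot_reprK.
Qed.

Lemma quot_scaleA (a b : A) (x : quot_mod S) :
  quot_scale a (quot_scale b x) = quot_scale (a * b) x.
Proof. by rewrite -(quot_reprK x) !quot_scale_pi mulrA. Qed.

Lemma quot_scale1 : left_id 1 quot_scale.
Proof. by move=> x; rewrite -(quot_reprK x) quot_scale_pi mul1r. Qed.

Lemma quot_scaleDr : right_distributive quot_scale +%R.
Proof.
move=> a x y; rewrite -(quot_reprK x) -(quot_reprK y) -quot_piD.
by rewrite !quot_scale_pi mulrDr quot_piD.
Qed.

Lemma quot_scaleDl (x : quot_mod S) :
  {morph quot_scale^~ x : a b / a + b}.
Proof.
by move=> a b; rewrite -(quot_reprK x) !quot_scale_pi mulrDl quot_piD.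
Qed.

HB.instance Definition _ :=
  GRing.Zmodule_isLmodule.Build A (quot_mod S)
    quot_scaleA quot_scale1 quot_scaleDr quot_scaleDl.

End QuotMod.

Section Graded.
Variables (K : fieldType) (N : nat).
Local Notation R := {mpoly K[N]}.

Definition cover_monomials (G : graph 'I_N) : seq R :=
  [seq \prod_(v in w) 'X_v | w : {set 'I_N} <- enum (vertex_cover G)].

Definition zhomog (d : int) (p : R) : bool :=
  match d with
  | Posz k => p \is k.-homog
  | Negz _ => p == 0
  end.

(* A grading of M is given by its homogeneous pieces: gr d x means x \in M_d. *)
Definition grading (M : lmodType R) := int -> M -> Prop.

Definition ideal_grading (S : seq R) : grading (ideal_mod S) :=
  fun d x => zhomog d (ideal_val x).

Definition quot_grading (S : seq R) : grading (quot_mod S) :=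
  fun d x => exists2 f : R, zhomog d f & quot_pi S f = x.

(* F_i = \bigoplus_k R(- (shifts i)`_k), elements being column vectors, so    *)
(* the k-th basis vector of F_i has degree (shifts i)`_k; diff i is the       *)
(* matrix of F_{i+1} -> F_i, acting on the left.                              *)
Record gfree := GFree {
  shifts : nat -> seq int;
  diff : forall i, 'M[R]_(size (shifts i), size (shifts i.+1))
}.

Definition gfree_homogeneous (F : gfree) : Prop :=
  forall i (a : 'I_(size (shifts F i))) (b : 'I_(size (shifts F i.+1))),
    zhomog ((shifts F i.+1)`_b - (shifts F i)`_a) (diff F i a b).

(* The map F_0 -> M sending the k-th basis vector to e k.                     *)
Definition augmentation (M : lmodType R) (F : gfree)
    (e : 'I_(size (shifts F 0)) -> M) (v : 'cV[R]_(size (shifts F 0))) : M :=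
  \sum_k v k 0 *: e k.

Record is_gfree_resolution (M : lmodType R) (gr : grading M) (F : gfree)
    (e : 'I_(size (shifts F 0)) -> M) : Prop := {
  gfree_res_homog : gfree_homogeneous F;
  gfree_res_aug_homog : forall k : 'I_(size (shifts F 0)),
    gr (shifts F 0)`_k (e k);
  gfree_res_aug_surj : forall x : M, exists v, augmentation e v = x;
  gfree_res_aug_exact : forall v,
    augmentation e v = 0 <-> exists u, v = diff F 0 *m u;
  gfree_res_exact : forall i (v : 'cV[R]_(size (shifts F i.+1))),
    diff F i *m v = 0 <-> exists u, v = diff F i.+1 *m u
}.

Definition resolves (M : lmodType R) (gr : grading M) (F : gfree) : Prop :=
  exists e : 'I_(size (shifts F 0)) -> M, is_gfree_resolution gr e.

(* The image of F_{i+1} lies in \mathfrak{m} F_i, where \mathfrak{m} is the   *)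
(* ideal of polynomials with zero constant term.                              *)
Definition minimal (F : gfree) : Prop :=
  forall i a b, (diff F i a b)@_0%MM = 0.

(* The differentials of F \otimes_R K, where K = R / \mathfrak{m}.            *)
Definition diff_tensor (F : gfree) i :
    'M[K]_(size (shifts F i), size (shifts F i.+1)) :=
  map_mx (mcoeff 0%MM) (diff F i).

Definition tensor_cycle (F : gfree) i : 'cV[K]_(size (shifts F i)) -> Prop :=
  match i with
  | 0 => fun=> True
  | i'.+1 => fun v => diff_tensor F i' *m v = 0
  end.

Definition tensor_boundary (F : gfree) i (v : 'cV[K]_(size (shifts F i))) :
    Prop :=
  exists u : 'cV[K]_(size (shifts F i.+1)), v = diff_tensor F i *m u.

Definition tensor_degree (F : gfree) i (j : int)
    (v : 'cV[K]_(size (shifts F i))) : Prop :=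
  forall k : 'I_(size (shifts F i)), v k 0 != 0 -> (shifts F i)`_k = j.

(* Tor_i^R(M, K)_j != 0, i.e. H_i(F \otimes_R K)_j != 0 for a graded free     *)
(* resolution F of M; up to isomorphism, Tor does not depend on F.            *)
Definition Tor_nonzero (M : lmodType R) (gr : grading M) (i : nat) (j : int) :
    Prop :=
  exists F, resolves gr F /\
    exists v : 'cV[K]_(size (shifts F i)),
      [/\ tensor_degree j v, tensor_cycle v & ~ tensor_boundary v].

Definition has_regularity (M : lmodType R) (gr : grading M) (r : int) : Prop :=
  (exists i j, Tor_nonzero gr i j /\ j - i%:Z = r) /\
  (forall i j, Tor_nonzero gr i j -> j - i%:Z <= r).

End Graded.

(* The ambient type 'I_(n + m) lists x_1, ..., x_n, y_1, ..., y_m: lshift m i *)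
(* is x_{i+1} and rshift n j is y_{j+1}.                                      *)
Definition xblock (n m a b : nat) : {set 'I_(n + m)} :=
  [set lshift m i | i : 'I_n & (a <= i < b)%N].

Definition yblock (n m a b : nat) : {set 'I_(n + m)} :=
  [set rshift n j | j : 'I_m & (a <= j < b)%N].

(* Main.v *)
(* Write a, b, c, d for the products of the variables in U1, U2, V1, V2. The  *)
(* minimal vertex covers of G are the unions of U1 and V2, of V1 and V2, and  *)
(* of U1 and U2, so J = (ad, cd, ab). If v0 ad + v1 cd + v2 ab = 0 then a     *)
(* divides v1 and d divides v2 by coprimality, and cancelling ad expresses    *)
(* v0; hence the syzygies are freely generated by (b, 0, -d) and (c, -a, 0).  *)
(* For the regularity, a graded resolution F of J is compared with this       *)
(* resolution P: there are lifts phi : F -> P, psi : P -> F of the identity   *)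
(* with psi phi homotopic to 1, and only phi has to be homogeneous. If j is   *)
(* not a shift of P_i, a cycle of degree j in F_i (x) K is killed by          *)
(* phi (x) K, hence is a boundary; so Tor_i lives in the degrees of the       *)
(* shifts of P_i.                                                             *)

Require Import Defs.
From mathcomp Require Import all_boot all_order all_algebra.
From mathcomp Require Import mpoly.
From mathcomp Require Import boolp ring zify.
Import Order.TTheory GRing.Theory Num.Theory.
Local Open Scope ring_scope.

Set Implicit Arguments.
Unset Strict Implicit.
Unset Printing Implicit Defensive.

(** The resolution is the Hilbert-Burch complex of three covers: [cover_idealE] replaces all covers
    by them, [sqfree_coprime] supplies the coprimalities under which [hb_exact] computes the
    syzygies, and no entry has a constant term because the four blocks are nonempty. Dropping R from
    it resolves J. [Tor_nonzero] may be witnessed by any graded resolution of J, so the upper bound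
    on the regularity has to treat all of them: [comparison] relates an arbitrary one to the
    explicit one, and [tensor_homology_degree] concludes that only shifts of the explicit one occur.
    For the lower bound, minimality makes both basis vectors of the last term survive in Tor_1; the
    larger of their degrees, minus one, bounds the degrees of the three generators. *)

(** * Squarefree monomials and their coprimality *)

Section SquarefreeMonomial.
Variables (K : fieldType) (N : nat).
Local Notation R := {mpoly K[N]}.
Implicit Types (A B : {set 'I_N}) (p q : R).

Definition sqfree A : R := \prod_(v in A) 'X_v.

Definition mnm_set A : 'X_{1..N} := (\sum_(v in A) U_(v))%MM.

Lemma mnm_setE A i : mnm_set A i = (i \in A).
Proof.
rewrite mnm_sumE big_mkcond (bigD1 i) //= big1 ?addn0; last first.
  by move=> v /negPf nvi; rewrite mnm1E nvi if_same.
by rewrite mnm1E eqxx; case: (i \in A).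
Qed.

Lemma sqfreeE A : sqfree A = 'X_[mnm_set A].
Proof. exact: mprodXE. Qed.

Lemma sqfree_neq0 A : sqfree A != 0.
Proof. by rewrite sqfreeE -msupp_eq0 msuppX. Qed.

Lemma sqfreeU A B : [disjoint A & B] -> sqfree (A :|: B) = sqfree A * sqfree B.
Proof.
move=> dAB; rewrite /sqfree (eq_bigl [predU A & B]) ?bigU // => v.
by rewrite !inE.
Qed.

Lemma sqfree_homog A : sqfree A \is #|A|.-homog.
Proof.
rewrite sqfreeE dhomogX /= mdeg_sum (eq_bigr (fun=> 1%N)).
  by rewrite sum1_card.
by move=> v _; rewrite mdeg1.
Qed.

Lemma sqfree_dvd A B : A \subset B -> sqfree B = sqfree (B :\: A) * sqfree A.
Proof.
move=> sAB; rewrite -sqfreeU; last first.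
  by rewrite disjoint_sym disjoints_subset setCD subsetUr.
by rewrite setUC -{1}(setIidPr sAB) setID.
Qed.

(** Variables of A do not occur in [sqfree B], so every monomial of p is divisible by [sqfree A];
    dividing p term by term gives r. *)
Lemma sqfree_coprime A B p q : [disjoint A & B] ->
  p * sqfree B = q * sqfree A -> exists r, p = r * sqfree A.
Proof.
rewrite !sqfreeE; move=> dAB eqpq.
have le_supp m : m \in msupp p -> (mnm_set A <= m)%MM.
  rewrite mcoeff_msupp -(mcoeffMX p (mnm_set B)) eqpq => nz.
  have : (mnm_set B + m)%MM \in msupp (q * 'X_[mnm_set A]).
    by rewrite mcoeff_msupp.
  rewrite (perm_mem (msuppMX _ _)) => /mapP[m' _ /mnmP em].
  apply/mnm_lepP => i; have := em i; rewrite !mnmDE !mnm_setE.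
  case: (boolP (i \in A)) => // iA.
  by rewrite (disjointFr dAB iA) add0n => ->.
exists (\sum_(m <- msupp p) p@_m *: 'X_[m - mnm_set A]).
rewrite mulr_suml {1}[p]mpolyE [LHS]big_seq [RHS]big_seq.
by apply: eq_bigr => m /le_supp le; rewrite -scalerAl -mpolyXD submK.
Qed.

End SquarefreeMonomial.

(** * Homogeneous components of polynomials and matrices *)

Section HomogeneousComponent.
Variables (K : fieldType) (N : nat).
Local Notation R := {mpoly K[N]}.
Implicit Types (d e : int) (p q : R) (r s t : seq int).

Definition zpihomog d p : R := if d is Posz k then pihomog mdeg k p else 0.

Lemma mcoeff_zpihomog d p m :
  (zpihomog d p)@_m = if (mdeg m)%:Z == d then p@_m else 0.
Proof.
case: d => k /=; last by rewrite mcoeff0.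
rewrite pihomogE raddf_sum /= eqz_nat.
under eq_bigr do rewrite mcoeffZ mcoeffX.
case: (boolP (m \in msupp p)) => mp.
  rewrite big_mkcond (bigD1_seq m) //= eqxx mulr1 big1 ?addr0 //.
  by move=> i /negPf ->; rewrite mulr0 if_same.
rewrite (memN_msupp_eq0 mp) if_same big_seq_cond big1 // => i /andP[ip _].
by case: eqP => [eim|]; [rewrite -eim ip in mp | rewrite mulr0].
Qed.

Lemma zhomogP d p :
  reflect (forall m, p@_m != 0 -> (mdeg m)%:Z = d) (zhomog d p).
Proof.
case: d => k /=; apply: (iffP idP).
- by move/dhomogP => h m; rewrite -mcoeff_msupp => /h /= ->.
- by move=> h; apply/dhomogP => m; rewrite mcoeff_msupp => /h [].
- by move/eqP-> => m; rewrite mcoeff0 eqxx.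
- move=> h; apply/eqP/mpolyP => m; rewrite mcoeff0.
  by apply/eqP/negPn/negP => /h.
Qed.

Lemma zpihomogP d p : zhomog d (zpihomog d p).
Proof.
apply/zhomogP => m; rewrite mcoeff_zpihomog.
by case: ifP => [/eqP|_]; rewrite ?eqxx.
Qed.

Lemma zpihomog_id d p : zhomog d p -> zpihomog d p = p.
Proof.
move/zhomogP => h; apply/mpolyP => m; rewrite mcoeff_zpihomog.
by case: (eqVneq p@_m 0) => [->|/h ->]; rewrite ?if_same ?eqxx.
Qed.

Lemma zpihomog_sum (I : finType) d (f : I -> R) :
  zpihomog d (\sum_i f i) = \sum_i zpihomog d (f i).
Proof.
apply/mpolyP => m; rewrite mcoeff_zpihomog !(raddf_sum (mcoeff m)) /=.
under [RHS]eq_bigr do rewrite mcoeff_zpihomog.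
by case: ifP => // _; rewrite big1.
Qed.

Lemma zpihomogM d e p q :
  zhomog d p -> zpihomog (d + e) (p * q) = p * zpihomog e q.
Proof.
move/zhomogP => hp; apply/mpolyP => m; rewrite mcoeff_zpihomog !mcoeffM.
(* The degree test moves inside the convolution sum, to be compared term by term. *)
rewrite (_ : (if _ then _ else _) =
  \sum_(k : 'X_{1..N < (mdeg m).+1, (mdeg m).+1} | m == (k.1 + k.2)%MM)
   (if (mdeg m)%:Z == d + e then p@_k.1 * q@_k.2 else 0)); last first.
  by case: ifP => // _; rewrite big1.
apply: eq_bigr => -[[/= u _] [/= v _]] /eqP ->; rewrite mcoeff_zpihomog.
case: (eqVneq p@_u 0) => [->|/hp degu]; first by rewrite !mul0r if_same.
by rewrite mdegD PoszD degu (inj_eq (addrI d)); case: ifP; rewrite ?mulr0.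
Qed.

(** This says that A is a degree-0 map from the sum of the R(-t_b) to the sum of the R(-s_a). *)
Definition homog_mx s t (A : 'M[R]_(size s, size t)) : Prop :=
  forall (a : 'I_(size s)) (b : 'I_(size t)), zhomog (t`_b - s`_a) (A a b).

Definition pihomog_mx s t (A : 'M[R]_(size s, size t)) :
    'M[R]_(size s, size t) :=
  \matrix_(a, b) zpihomog (t`_b - s`_a) (A a b).

Lemma pihomog_mxP s t (A : 'M[R]_(size s, size t)) : homog_mx (pihomog_mx A).
Proof. by move=> a b; rewrite mxE zpihomogP. Qed.

Lemma pihomog_mx_id s t (A : 'M[R]_(size s, size t)) :
  homog_mx A -> pihomog_mx A = A.
Proof. by move=> hA; apply/matrixP => a b; rewrite mxE zpihomog_id. Qed.

Lemma pihomog_mxM r s t (A : 'M[R]_(size r, size s))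
    (B : 'M[R]_(size s, size t)) :
  homog_mx A -> pihomog_mx (A *m B) = A *m pihomog_mx B.
Proof.
move=> hA; apply/matrixP => a b; rewrite !mxE zpihomog_sum.
apply: eq_bigr => k _.
(* The degree t_b - r_a splits as (s_k - r_a) + (t_b - s_k). *)
by rewrite mxE -(zpihomogM _ _ (hA a k)) -(subrKA s`_k) addrC.
Qed.

Lemma homog_mxM r s t (A : 'M[R]_(size r, size s))
    (B : 'M[R]_(size s, size t)) :
  homog_mx A -> homog_mx B -> homog_mx (A *m B).
Proof.
move=> hA hB; rewrite -(pihomog_mx_id hB) -pihomog_mxM //.
exact: pihomog_mxP.
Qed.

(** The degree-0 part of any factor B still works, so lifts may be found without regard to the
    grading. *)
Lemma homog_mx_factor r s t (A : 'M[R]_(size r, size t))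
    (D : 'M[R]_(size r, size s)) :
  homog_mx A -> homog_mx D -> (exists B, A = D *m B) ->
  exists B, homog_mx B /\ A = D *m B.
Proof.
move=> hA hD [B eA]; exists (pihomog_mx B); split; first exact: pihomog_mxP.
by rewrite -pihomog_mxM // -eA pihomog_mx_id.
Qed.

(** Constants have degree 0, so modulo the irrelevant ideal a graded map only links basis vectors of
    equal degree. *)
Lemma homog_mx_mcoeff0 s t (A : 'M[R]_(size s, size t))
    (a : 'I_(size s)) (b : 'I_(size t)) :
  homog_mx A -> (A a b)@_0%MM != 0 -> t`_b = s`_a.
Proof.
by move=> hA /(zhomogP _ _ (hA a b)); rewrite mdeg0 => /esym/eqP;
  rewrite subr_eq0 => /eqP.
Qed.

End HomogeneousComponent.

(** * Ideals and exactness in terms of matrices *)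

Section IdealGen.
Variable A : comNzRingType.
Implicit Types (S : seq A) (f : A).

Definition gens_row S : 'rV[A]_(size S) := \row_k S`_k.

Lemma ideal_genP S f :
  f \in ideal_gen S <-> exists u : 'cV_(size S), f = (gens_row S *m u) 0 0.
Proof.
split=> [/asboolP[c ->]|[u ->]].
  exists (\col_k c k); rewrite mxE; apply: eq_bigr => k _.
  by rewrite !mxE mulrC.
apply/asboolP; exists (fun k => u k 0); rewrite mxE; apply: eq_bigr => k _.
by rewrite !mxE mulrC.
Qed.

Lemma mem_ideal_gen S f : f \in S -> f \in ideal_gen S.
Proof.
rewrite -index_mem => lt_f; apply/ideal_genP.
exists (delta_mx (Ordinal lt_f) 0); rewrite -colE !mxE nth_index //.
by rewrite -index_mem.
Qed.

Lemma sub_ideal_gen S S' : {subset S <= ideal_gen S'} ->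
  {subset ideal_gen S <= ideal_gen S'}.
Proof.
move=> sSS' f /asboolP[c ->]; apply: (@rpred_sum A^o) => k _.
by apply: (@rpredZ A A^o); apply/sSS'/mem_nth.
Qed.

End IdealGen.

Section ExactMatrices.
Variable A : nzRingType.

Definition exact_mx m n p (D : 'M[A]_(m, n)) (D' : 'M[A]_(n, p)) : Prop :=
  forall v : 'cV_n, D *m v = 0 <-> exists u, v = D' *m u.

Lemma mx_factor m n p (B : 'M[A]_(m, p)) (D : 'M[A]_(m, n)) :
  (forall j, exists u, col j B = D *m u) -> exists C, B = D *m C.
Proof.
move=> /choice[u hu]; exists (\matrix_(i, j) u j i 0).
apply/matrixP => i j; have /matrixP/(_ i 0) := hu j; rewrite !mxE => ->.
by apply: eq_bigr => k _; rewrite !mxE.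
Qed.

Variables (m n p : nat) (D : 'M[A]_(m, n)) (D' : 'M[A]_(n, p)).
Hypothesis exD : exact_mx D D'.

Lemma exact_mx_factor q (B : 'M[A]_(n, q)) :
  D *m B = 0 -> exists C, B = D' *m C.
Proof.
move=> DB0; apply: mx_factor => j; apply/exD.
by rewrite !colE mulmxA DB0 mul0mx.
Qed.

Lemma exact_mx_mul0 : D *m D' = 0.
Proof.
apply/matrixP => i j; have /matrixP/(_ i 0) : D *m col j D' = 0.
  by apply/exD; exists (delta_mx j 0); rewrite colE.
by rewrite colE mulmxA -colE !mxE.
Qed.

End ExactMatrices.

(** * Comparison of graded resolutions of an ideal, and the degrees of Tor *)

Section Comparison.
Variables (K : fieldType) (N : nat) (S : seq {mpoly K[N]}).
Local Notation R := {mpoly K[N]}.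
Local Notation J := (ideal_mod S : lmodType R).
Local Notation grJ := (ideal_grading (S := S) : grading J).
Implicit Types F P : gfree K N.

(** R is placed in degree 0 below F_0, so that the composite of F_0 -> J with the inclusion into R
    is a matrix too, and exactness at F_0 reads as at the other levels. *)
Definition aug_shifts F i : seq int :=
  if i is i'.+1 then shifts F i' else [:: 0].

Definition aug_diff F (e : 'I_(size (shifts F 0)) -> J) i :
    'M[R]_(size (aug_shifts F i), size (shifts F i)) :=
  match i with
  | 0 => \row_k ideal_val (e k)
  | i'.+1 => diff F i'
  end.

Lemma aug_diff0M F (e : 'I_(size (shifts F 0)) -> J) v :
  (aug_diff e 0 *m v) 0 0 = ideal_val (augmentation e v).
Proof.
rewrite -[RHS]/((val : J -> R^o) _) raddf_sum mxE; apply: eq_bigr => k _.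
by rewrite mxE mulrC.
Qed.

Section Resolution.
Variables (F : gfree K N) (e : 'I_(size (shifts F 0)) -> J).
Hypothesis resF : is_gfree_resolution grJ e.

Lemma aug_diff_homog i : homog_mx (aug_diff e i).
Proof.
case: i => [|i] a b; last exact: (gfree_res_homog resF).
by rewrite (ord1 a) subr0 mxE; apply: (gfree_res_aug_homog resF).
Qed.

Lemma aug_diff_exact i : exact_mx (aug_diff e i) (diff F i).
Proof.
case: i => [|i] v; last exact: (gfree_res_exact resF).
rewrite -(gfree_res_aug_exact resF); split=> [/matrixP/(_ 0 0)|ev0].
  by rewrite aug_diff0M mxE => ev0; apply/val_inj.
by apply/matrixP => i j; rewrite !ord1 aug_diff0M ev0 mxE.
Qed.

Lemma aug_diff0_factor P (e' : 'I_(size (shifts P 0)) -> J) :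
  exists C, aug_diff e' 0 = aug_diff e 0 *m C.
Proof.
apply: mx_factor => j; have [u eu] := gfree_res_aug_surj resF (e' j).
exists u; apply/matrixP => a b; rewrite !ord1 !mxE -eu -aug_diff0M.
by rewrite mxE.
Qed.

End Resolution.

Section ChainMaps.
Variables (F P : gfree K N).
Variables (eF : 'I_(size (shifts F 0)) -> J) (eP : 'I_(size (shifts P 0)) -> J).
Hypothesis (resF : is_gfree_resolution grJ eF).
Hypothesis (resP : is_gfree_resolution grJ eP).

(* Here k is the homotopy one step below.  The invariant only involves two    *)
(* consecutive levels, so induction suffices and no choice of an infinite     *)
(* sequence of matrices is needed; k = 0 at level 0 because there a tensor    *)
(* cycle need not be killed by the augmentation.                              *)
Lemma comparison i :
  exists (phi : 'M_(size (shifts P i), size (shifts F i)))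
    (psi : 'M_(size (shifts F i), size (shifts P i))) h k,
  [/\ homog_mx phi,
      aug_diff eP i *m phi *m diff F i = 0,
      aug_diff eF i *m psi *m diff P i = 0,
      psi *m phi - 1%:M = diff F i *m h + k *m aug_diff eF i &
      i = 0%N -> k = 0].
Proof.
have exF := aug_diff_exact resF; have exP := aug_diff_exact resP.
have dF0 j := exact_mx_mul0 (exF j); have dP0 j := exact_mx_mul0 (exP j).
elim: i => [|i [phi [psi [h [k [hphi phiP psiP hk _]]]]]].
  have [phi [hphi ephi]] := homog_mx_factor (aug_diff_homog resF (i := 0))
    (aug_diff_homog resP (i := 0)) (aug_diff0_factor resP eF).
  have [psi epsi] := aug_diff0_factor resF eP.
  have [|h eh] := exact_mx_factor (exF 0%N) (B := psi *m phi - 1%:M).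
    by rewrite mulmxBr mulmxA -epsi -ephi mulmx1 subrr.
  exists phi, psi, h, 0; rewrite mul0mx addr0 -ephi -epsi.
  by split=> //; [exact: (dF0 0%N) | exact: (dP0 0%N)].
have [phi' [hphi' ephi]] : exists phi', homog_mx phi' /\
    phi *m diff F i = diff P i *m phi'.
  apply: homog_mx_factor.
  - exact: homog_mxM hphi (aug_diff_homog resF (i := i.+1)).
  - exact: (aug_diff_homog resP (i := i.+1)).
  - by apply: (exact_mx_factor (exP i)); rewrite mulmxA.
have [psi' epsi] : exists psi', psi *m diff P i = diff F i *m psi'.
  by apply: (exact_mx_factor (exF i)); rewrite mulmxA.
(* With d the differentials of F, d (psi' phi' - 1 - h d) = (psi phi - 1 - d h) d = k d d = 0, so
   exactness provides the next homotopy. *)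
have [|h' eh] := exact_mx_factor (exF i.+1)
  (B := psi' *m phi' - 1%:M - h *m diff F i).
  rewrite /= !mulmxBr mulmx1 !mulmxA -epsi -[psi *m _ *m _]mulmxA -ephi mulmxA.
  rewrite -[X in _ - X - _]mul1mx -!mulmxBl hk [_ + k *m _]addrC addrK.
  by rewrite -mulmxA dF0 mulmx0.
exists phi', psi', h', h; split=> //=.
- by rewrite -ephi -mulmxA [diff F i *m _](dF0 i.+1) mulmx0.
- by rewrite -epsi -mulmxA [diff P i *m _](dP0 i.+1) mulmx0.
- by rewrite -eh subrK.
Qed.

Lemma tensor_homology_degree i j (v : 'cV[K]_(size (shifts F i))) :
  tensor_degree j v -> tensor_cycle v -> ~ tensor_boundary v ->
  j \in shifts P i.
Proof.
move=> degv cycv; apply: contra_notT => /negP nj.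
have [phi [psi [h [k [hphi _ _ hk k0]]]]] := comparison i.
(* A nonzero term would equate j, the degree of v, with a shift of P_i. *)
have phiv0 : map_mx (mcoeff 0%MM) phi *m v = 0.
  apply/matrixP => a b; rewrite ord1 !mxE big1 // => c _; rewrite mxE.
  have [->|vc] := eqVneq (v c 0) 0; first by rewrite mulr0.
  have [->|/(homog_mx_mcoeff0 hphi) ec] := eqVneq ((phi a c)@_0%MM) 0.
    by rewrite mul0r.
  by case: nj; rewrite -(degv _ vc) ec mem_nth.
have := congr1 (fun B => map_mx (mcoeff 0%MM) B *m v) hk.
rewrite /= map_mxB map_mxD !map_mxM map_mx1 mulmxBl mulmxDl -!mulmxA phiv0.
(* The k term vanishes: at level 0 because k = 0, above it because v is a cycle. What remains is -v
   = d h v. *)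
rewrite mulmx0 mul1mx sub0r (_ : map_mx _ k *m _ = 0) ?addr0; last first.
  case: i v degv cycv k k0 {phi psi hphi phiv0 hk h nj} => [|i] v _ cycv k k0.
    by rewrite k0 // map_mx0 mul0mx.
  by rewrite [X in _ *m X]cycv mulmx0.
move=> ev; exists (- (map_mx (mcoeff 0%MM) h *m v)).
by rewrite mulmxN -ev opprK.
Qed.

End ChainMaps.

Lemma Tor_degree P i j :
  resolves grJ P -> Tor_nonzero grJ i j -> j \in shifts P i.
Proof.
move=> [eP resP] [F [[eF resF] [v [degv cycv nbv]]]].
exact: (tensor_homology_degree resF resP degv cycv nbv).
Qed.

End Comparison.

(** * Syzygies of ad, cd, ab over an integral domain *)

Section HilbertBurch.
Variables (A : idomainType) (a b c d : A).

Definition hb_gens : seq A := [:: a * d; c * d; a * b].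

(** The Hilbert-Burch matrix: up to sign, its 2x2 minors are the entries of [hb_gens]. *)
Definition hb_syz : 'M[A]_(3, 2) :=
  \matrix_(i, j) nth 0 (nth [::] [:: [:: b; c]; [:: 0; - a]; [:: - d; 0]] i) j.

Lemma hb_gensM (v : 'cV_3) :
  (gens_row hb_gens *m v) 0 0 =
    v 0 0 * (a * d) + v 1 0 * (c * d) + v 2 0 * (a * b).
Proof.
rewrite mxE big_ord_recl big_ord_recl big_ord1 !mxE /= addrA.
congr (_ + _ + _); rewrite mulrC; congr (v _ _ * _); exact: val_inj.
Qed.

Lemma hb_syzM (u : 'cV_2) (i : 'I_3) :
  (hb_syz *m u) i 0 =
  [:: u 0 0 * b + u 1 0 * c; - (u 1 0 * a); - (u 0 0 * d)]`_i.
Proof.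
rewrite mxE big_ord_recl big_ord1 !mxE.
have -> : lift ord0 ord0 = 1 :> 'I_2 by exact: val_inj.
by case: i => -[|[|[|]]] //= _; ring.
Qed.

Hypotheses (a0 : a != 0) (d0 : d != 0).

Lemma hb_syz_inj (u : 'cV_2) : hb_syz *m u = 0 -> u = 0.
Proof.
move=> /matrixP u0; apply/matrixP => i j; rewrite ord1 mxE.
have := u0 2 0; have := u0 1 0; rewrite !hb_syzM !mxE /=.
move=> /eqP; rewrite oppr_eq0 mulf_eq0 (negPf a0) orbF => /eqP u1.
move=> /eqP; rewrite oppr_eq0 mulf_eq0 (negPf d0) orbF => /eqP u2.
by case: i => -[|[|]] // lt_i; [rewrite -u2 | rewrite -u1]; congr (u _ _);
  apply: val_inj.
Qed.

(** Coprimality of a to cd, and below of d to ab, phrased as divisibility because A is an arbitrary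
    integral domain. *)
Hypothesis a_cd : forall p q, p * (c * d) = q * a -> exists r, p = r * a.
Hypothesis d_ab : forall p q, p * (a * b) = q * d -> exists r, p = r * d.

Lemma hb_exact : exact_mx (gens_row hb_gens) hb_syz.
Proof.
move=> v; split=> [/matrixP/(_ 0 0)|[u ->]].
  rewrite hb_gensM mxE => v0.
  have [|r er] := a_cd (p := v 1 0) (q := - (v 0 0 * d + v 2 0 * b)).
    apply/eqP; rewrite -subr_eq0 -v0; apply/eqP; ring.
  have [|s es] := d_ab (p := v 2 0) (q := - (v 0 0 * a + v 1 0 * c)).
    apply/eqP; rewrite -subr_eq0 -v0; apply/eqP; ring.
  have e0 : v 0 0 = - s * b + - r * c.
    have /eqP : a * d * (v 0 0 + s * b + r * c) = 0.
      by rewrite -v0 er es; ring.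
    rewrite !mulf_eq0 (negPf a0) (negPf d0) /= => /eqP e0.
    by rewrite -[LHS]subr0 -e0; ring.
  (* The signs compensate the entries -d and -a of [hb_syz]. *)
  exists (\col_j nth 0 [:: - s; - r] j).
  apply/matrixP => i j; rewrite ord1 hb_syzM !mxE /=.
  by case: i => -[|[|[|]]] // lt_i /=; [rewrite -e0 | rewrite mulNr opprK -er
    | rewrite mulNr opprK -es]; congr (v _ _); apply: val_inj.
by apply/matrixP => i j; rewrite !ord1 hb_gensM !hb_syzM mxE /=; ring.
Qed.

End HilbertBurch.

Lemma quot_pi0P (A : comNzRingType) (S : seq A) (f : A) :
  quot_pi S f = 0 <-> f \in ideal_gen S.
Proof.
have -> : 0 = quot_pi S 0.
  by apply: (addrI (quot_pi S 0)); rewrite -quot_piD !addr0.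
by rewrite quot_piP subr0.
Qed.

(** * The cover ideal and the explicit resolutions of R/J and J *)

Section CoverIdeal.
Variables (K : fieldType) (N : nat) (U1 U2 V1 V2 : {set 'I_N}).
Local Notation R := {mpoly K[N]}.
Local Notation G := (graph_union (complete_bipartite U1 (V1 :|: V2))
  (complete_bipartite U2 V2)).

Local Notation min_covers := [:: U1 :|: V2; V1 :|: V2; U1 :|: U2].

(** A vertex of U1 missing from w forces its whole neighbourhood V1 and V2 into w. Otherwise w
    contains U1, and the same dichotomy for U2 leaves U2 or V2. *)
Lemma vertex_coverP (w : {set 'I_N}) : vertex_cover G w ->
  [\/ U1 :|: V2 \subset w, V1 :|: V2 \subset w | U1 :|: U2 \subset w].
Proof.
move=> /andP[_ /forall_inP cov].
have edge1 x y : x \in U1 -> y \in V1 :|: V2 -> (x \in w) || (y \in w).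
  move=> xU yV; have /cov : [set x; y] \in edges G.
    by rewrite inE; apply/orP; left; apply/imset2P; exists x y.
  by case/set0Pn => z; rewrite !inE => /andP[/orP[]/eqP-> ->]; rewrite ?orbT.
have edge2 x y : x \in U2 -> y \in V2 -> (x \in w) || (y \in w).
  move=> xU yV; have /cov : [set x; y] \in edges G.
    by rewrite inE; apply/orP; right; apply/imset2P; exists x y.
  by case/set0Pn => z; rewrite !inE => /andP[/orP[]/eqP-> ->]; rewrite ?orbT.
have [sU1|/subsetPn[x xU1 /negPf xw]] := boolP (U1 \subset w); last first.
  by apply: Or32; apply/subsetP => y /(edge1 _ _ xU1); rewrite xw.
have [sU2|/subsetPn[x xU2 /negPf xw]] := boolP (U2 \subset w).
  by apply: Or33; rewrite subUset sU1.
apply: Or31; rewrite subUset sU1; apply/subsetP => y.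
by move=> /(edge2 _ _ xU2); rewrite xw.
Qed.

Lemma minimal_covers (w : {set 'I_N}) :
  w \in min_covers -> vertex_cover G w.
Proof.
rewrite !inE => w3; apply/andP; split; last apply/forall_inP => e.
  apply/subsetP => x; case/or3P: w3 => /eqP-> /=; rewrite !inE;
  by do ![case: (x \in _)].
rewrite inE => /orP[] /imset2P[x y xU yV ->]; apply/set0Pn.
  case/or3P: w3 => /eqP->; [exists x|exists y|exists x];
  by rewrite !inE eqxx ?xU -?in_setU ?yV ?orbT.
case/or3P: w3 => /eqP->; [exists y|exists y|exists x];
by rewrite !inE eqxx ?xU ?yV ?orbT.
Qed.

Hypotheses (dU1V1 : [disjoint U1 & V1]) (dU1V2 : [disjoint U1 & V2])
  (dU1U2 : [disjoint U1 & U2]) (dV1V2 : [disjoint V1 & V2])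
  (dU2V2 : [disjoint U2 & V2]).

Local Notation a := (sqfree K U1).
Local Notation b := (sqfree K U2).
Local Notation c := (sqfree K V1).
Local Notation d := (sqfree K V2).
Local Notation S := (cover_monomials K G).
Local Notation gens := (hb_gens a b c d).

(** The monomial of a cover is a multiple of that of any cover it contains. *)
Lemma cover_idealE : ideal_gen S =i ideal_gen gens.
Proof.
have gensE : gens = [seq sqfree K w | w <- min_covers].
  by rewrite /= !sqfreeU.
move=> f; apply/idP/idP; apply: sub_ideal_gen => g.
  case/mapP => w; rewrite mem_enum => /vertex_coverP cov ->.
  have dvd (w' : {set 'I_N}) : w' \subset w -> w' \in min_covers ->
    sqfree K w \in ideal_gen gens.
    move=> sw'w w'3; rewrite (sqfree_dvd _ sw'w).
    by apply: (@rpredZ R R^o); apply: mem_ideal_gen; rewrite gensE map_f.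
  by case: cov => /dvd; apply; rewrite !inE eqxx ?orbT.
rewrite gensE => /mapP[w w3 ->]; apply/mem_ideal_gen/map_f.
by rewrite mem_enum; apply: minimal_covers.
Qed.

Let a0 : a != 0 := sqfree_neq0 K U1.
Let d0 : d != 0 := sqfree_neq0 K V2.

Lemma sqfree_hb_exact : exact_mx (gens_row gens) (hb_syz a b c d).
Proof.
apply: hb_exact => // p q; rewrite -sqfreeU //; apply: sqfree_coprime.
  by rewrite -setI_eq0 setIUr setU_eq0 !setI_eq0 dU1V1.
by rewrite disjoint_sym -setI_eq0 setIUl setU_eq0 !setI_eq0 dU1V2.
Qed.

(** The two shifts at level 2 are the degrees of abd = lcm(ad, ab) and acd = lcm(ad, cd). *)
Definition hb_shifts i : seq int :=
  match i with
  | 0 => [:: 0]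
  | 1 => [:: (#|U1| + #|V2|)%N%:Z; (#|V1| + #|V2|)%N%:Z; (#|U1| + #|U2|)%N%:Z]
  | 2 => [:: (#|U1| + #|U2| + #|V2|)%N%:Z; (#|V1| + #|V2| + #|U1|)%N%:Z]
  | _ => [::]
  end.

Definition hb_diff i : 'M[R]_(size (hb_shifts i), size (hb_shifts i.+1)) :=
  match i with
  | 0 => gens_row gens
  | 1 => hb_syz a b c d
  | _ => 0
  end.

Definition hb_quot_res : gfree K N := GFree hb_diff.

Definition hb_ideal_res : gfree K N :=
  @GFree K N (fun i => hb_shifts i.+1) (fun i => hb_diff i.+1).

Lemma hb_diff_homog i : homog_mx (hb_diff i).
Proof.
have h (A B : {set 'I_N}) : sqfree K A * sqfree K B \is (#|A| + #|B|).-homog.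
  by apply: dhomogM; apply: sqfree_homog.
have zh (x y k : nat) p :
    x = (y + k)%N -> p \is k.-homog -> zhomog (x%:Z - y%:Z) p.
  by move=> -> hp; rewrite PoszD addrC addKr.
have z0 e : zhomog e (0 : R) by apply/zhomogP => m; rewrite mcoeff0 eqxx.
case: i => [|[|i]] [i1 lt1] [i2 lt2]; last by [].
  case: i1 lt1 => // lt1; rewrite mxE /= subr0.
  by move: i2 lt2 => [|[|[|]]] //= _; apply: h.
rewrite mxE /=; move: i1 lt1 i2 lt2 => [|[|[|]]] //= _ [|[|]] //= _.
- by apply: zh (sqfree_homog K U2); rewrite addnAC.
- by apply: zh (sqfree_homog K V1); rewrite addnC addnA addnAC.
- by apply: zh; last (rewrite dhomogN; apply: sqfree_homog).
- by apply: zh; last (rewrite dhomogN; apply: sqfree_homog).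
Qed.

Lemma hb_quot_minimal : U1 != set0 -> U2 != set0 -> V1 != set0 -> V2 != set0 ->
  minimal hb_quot_res.
Proof.
move=> neU1 neU2 neV1 neV2.
have sq0 A : A != set0 -> (sqfree K A)@_0%MM = 0.
  move=> neA; apply: (dhomog_nemf_coeff (sqfree_homog K A)).
  by rewrite mf0 eq_sym cards_eq0.
case=> [|[|i]] [i1 lt1] [i2 lt2] /=; last by rewrite mxE mcoeff0.
  rewrite mxE; move: i2 lt2 => [|[|[|]]] //= _;
  by rewrite rmorphM /= sq0 // mul0r.
rewrite mxE; move: i1 lt1 i2 lt2 => [|[|[|]]] //= _ [|[|]] //= _;
by rewrite ?raddfN /= ?mcoeff0 ?sq0 ?oppr0.
Qed.

Lemma hb_diff_exact i : exact_mx (hb_diff i) (hb_diff i.+1).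
Proof.
case: i => [|[|i]] v; first exact: sqfree_hb_exact; last first.
  split=> [_|_]; last by rewrite mul0mx.
  by exists 0; apply/matrixP => -[].
split=> [/hb_syz_inj v0|[u ->]]; last by rewrite mul0mx mulmx0.
by exists 0; rewrite mulmx0; apply: v0.
Qed.

Lemma hb_quot_resolves :
  resolves (quot_grading (S := S)) hb_quot_res.
Proof.
have augE (v : 'cV[R]_1) :
    augmentation (F := hb_quot_res) (fun=> quot_pi S 1) v = quot_pi S (v 0 0).
  rewrite /augmentation big_ord1 -[_ *: _]/(quot_scale _ _).
  by rewrite quot_scale_pi mulr1.
exists (fun=> quot_pi S 1); split.
- exact: hb_diff_homog.
- move=> [[|k] lt_k] //=; exists 1 => //; exact: dhomog1.
- by move=> x; exists (const_mx (quot_repr x)); rewrite augE mxE quot_reprK.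
- move=> v; rewrite augE quot_pi0P cover_idealE ideal_genP.
  split=> -[u eu]; exists u.
    by apply/matrixP => i j; rewrite !ord1 eu.
  by rewrite eu.
- exact: hb_diff_exact.
Qed.

Lemma hb_ideal_resolves : resolves (ideal_grading (S := S)) hb_ideal_res.
Proof.
have gJ (k : 'I_3) : (gens_row gens 0 k : R^o) \in ideal_gen S.
  by rewrite cover_idealE mxE mem_ideal_gen // mem_nth.
pose e (k : 'I_3) : ideal_mod S := IdealMod (gJ k).
have augE : aug_diff (F := hb_ideal_res) e 0 = gens_row gens.
  by apply/rowP => k; rewrite mxE.
have aug0 v := aug_diff0M (F := hb_ideal_res) e v; rewrite augE in aug0.
exists e; split.
- by move=> i; apply: (hb_diff_homog (i := i.+1)).
- by move=> k; have := hb_diff_homog (i := 0) 0 k; rewrite subr0.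
- move=> x; have := valP x; rewrite cover_idealE => /ideal_genP[u eu].
  by exists u; apply: val_inj; rewrite /= -aug0 -eu.
- move=> v; rewrite -(sqfree_hb_exact v); split=> [ev|/matrixP/(_ 0 0)].
    by apply/matrixP => i j; rewrite !ord1 aug0 ev mxE.
  by rewrite aug0 mxE => ev; apply: val_inj.
- by move=> i; apply: (hb_diff_exact (i := i.+1)).
Qed.

End CoverIdeal.

(** * Cardinality and disjointness of the vertex blocks *)

Section Blocks.
Variables (n m : nat).

Lemma card_ord_range p a b : (b <= p)%N ->
  #|[pred i : 'I_p | (a <= i < b)%N]| = (b - a)%N.
Proof.
move=> le_bp; rewrite -[RHS]muln1 -sum_nat_const_nat.
rewrite (big_nat_widen _ _ _ _ _ le_bp) (big_nat_widenl a 0) // big_mkord.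
rewrite -sum1_card.
by apply: eq_bigl => i; rewrite inE andbC.
Qed.

Lemma card_xblock a b : (b <= n)%N -> #|xblock n m a b| = (b - a)%N.
Proof.
move=> le_b; rewrite card_imset; last exact: lshift_inj.
rewrite -(card_ord_range a le_b).
by apply: eq_card => i; rewrite !inE.
Qed.

Lemma card_yblock a b : (b <= m)%N -> #|yblock n m a b| = (b - a)%N.
Proof.
move=> le_b; rewrite card_imset; last exact: rshift_inj.
rewrite -(card_ord_range a le_b).
by apply: eq_card => i; rewrite !inE.
Qed.

Lemma disjoint_xyblock a b a' b' : [disjoint xblock n m a b & yblock n m a' b'].
Proof.
rewrite -setI_eq0; apply/eqP/setP => v; rewrite !inE; apply/negP.
by case/andP => /imsetP[i _ ->] /imsetP[j _ /eqP]; rewrite eq_lrshift.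
Qed.

Lemma disjoint_xblock a b c : [disjoint xblock n m a b & xblock n m b c].
Proof.
rewrite -setI_eq0; apply/eqP/setP => v; rewrite !inE; apply/negP.
case/andP => /imsetP[i + ->] /imsetP[j + /lshift_inj eij].
by rewrite !inE eij => /andP[_ lt] /andP[+ _]; rewrite leqNgt lt.
Qed.

Lemma disjoint_yblock a b c : [disjoint yblock n m a b & yblock n m b c].
Proof.
rewrite -setI_eq0; apply/eqP/setP => v; rewrite !inE; apply/negP.
case/andP => /imsetP[i + ->] /imsetP[j + /rshift_inj eij].
by rewrite !inE eij => /andP[_ lt] /andP[+ _]; rewrite leqNgt lt.
Qed.

End Blocks.

Theorem theorem3p4 (K : fieldType) (n n1 n2 m m1 m2 : nat)
    (hn : n = (n1 + n2)%N) (hm : m = (m1 + m2)%N)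
    (hn1 : (1 <= n1)%N) (hn2 : (1 <= n2)%N)
    (hm1 : (1 <= m1)%N) (hm2 : (1 <= m2)%N) :
  let U1 := xblock n m 0 n1 in
  let U2 := xblock n m n1 n in
  let V1 := yblock n m 0 m1 in
  let V2 := yblock n m m1 m in
  let V := V1 :|: V2 in
  let G := graph_union (complete_bipartite U1 V) (complete_bipartite U2 V2) in
  let gensJ : seq {mpoly K[n + m]} := cover_monomials K G in
  let J : lmodType {mpoly K[n + m]} := ideal_mod gensJ in
  let RJ : lmodType {mpoly K[n + m]} := quot_mod gensJ in
  (exists F : gfree K (n + m),
    [/\ resolves (M := RJ) (quot_grading (S := gensJ)) F,
        minimal F,
        shifts F 0 = [:: 0],
        shifts F 1 = [:: (n1 + m2)%N%:Z; m%:Z; n%:Z] &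
        shifts F 2 = [:: (n + m2)%N%:Z; (m + n1)%N%:Z] /\
        (forall i, (2 < i)%N -> shifts F i = [::])])
  /\
  has_regularity (M := J) (ideal_grading (S := gensJ))
    (Num.max ((n + m2)%N%:Z - 1) ((m + n1)%N%:Z - 1)).
Proof.
move=> U1 U2 V1 V2 V G gensJ J RJ.
have cU1 : #|U1| = n1 by rewrite card_xblock ?subn0 // hn leq_addr.
have cU2 : #|U2| = n2 by rewrite card_xblock // hn addKn.
have cV1 : #|V1| = m1 by rewrite card_yblock ?subn0 // hm leq_addr.
have cV2 : #|V2| = m2 by rewrite card_yblock // hm addKn.
have dUV := disjoint_xyblock.
have dU := disjoint_xblock n m 0 n1 n; have dV := disjoint_yblock n m 0 m1 m.
pose F := hb_quot_res K U1 U2 V1 V2; pose P := hb_ideal_res K U1 U2 V1 V2.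
have minF : minimal F.
  apply: hb_quot_minimal; rewrite -card_gt0 ?cU1 ?cU2 ?cV1 ?cV2 //.
have resP : resolves (ideal_grading (S := gensJ)) P.
  by apply: hb_ideal_resolves; rewrite ?dUV //.
split.
  exists F; split=> //.
  - by apply: hb_quot_resolves; rewrite ?dUV //.
  - by rewrite /= cU1 cU2 cV1 cV2 -hn -hm.
  - split; first by rewrite /= cU1 cU2 cV1 cV2 -hn -hm.
    by case=> [|[|[|]]].
have shP1 : shifts P 1 = [:: (n + m2)%N%:Z; (m + n1)%N%:Z].
  by rewrite /= cU1 cU2 cV1 cV2 -hn -hm.
(* The incoming differential is zero and, by minimality, the outgoing one vanishes after tensoring
   with K, so each basis vector of P_1 is a cycle that does not bound. *)
have TorP1 (b : 'I_2) :
    Tor_nonzero (ideal_grading (S := gensJ)) 1 (shifts P 1)`_b.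
  exists P; split=> //; exists (delta_mx b 0); split.
  - by move=> k; rewrite mxE andbT; case: (k =P b) => [->|_] //; rewrite eqxx.
  - apply/matrixP => i j; rewrite !mxE big1 // => k _.
    by rewrite mxE (minF 1%N) mul0r.
  - case=> u /matrixP/(_ b 0); rewrite !mxE !eqxx big1 => [/eqP|k _].
      by rewrite oner_eq0.
    by rewrite !mxE mcoeff0 mul0r.
split.
  have [le|le] := leP ((n + m2)%N%:Z - 1) ((m + n1)%N%:Z - 1).
    by exists 1%N, (m + n1)%N%:Z; split=> //; have := TorP1 1; rewrite shP1.
  by exists 1%N, (n + m2)%N%:Z; split=> //; have := TorP1 0; rewrite shP1.
move=> i j /(Tor_degree resP); case: i => [|[|i]] /=.
(* As the blocks are nonempty, n1 + m2 and n are at most n + m2 - 1, and m is at most m + n1 - 1. *)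
- rewrite cU1 cU2 cV1 cV2 !inE => /or3P[]/eqP->; lia.
- rewrite cU1 cU2 cV1 cV2 !inE => /orP[]/eqP->; lia.
- by case: i.
Qed.
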